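(* In the setting described in the context, let $\boldsymbol{\alpha}:=(\boldsymbol{\beta}',\boldsymbol{\lambda}')'$ and define $\widetilde{\boldsymbol{\alpha}}=(\widetilde{\boldsymbol{\beta}}',\widetilde{\boldsymbol{\lambda}}')'$ as $$\widetilde{\boldsymbol{\alpha}}:=\arg\min_{\boldsymbol{\alpha}}\left(\dot{\boldsymbol{y}}-\dot{\boldsymbol{X}}\boldsymbol{\beta}\right)'\boldsymbol{M}(\boldsymbol{\lambda})\left(\dot{\boldsymbol{y}}-\dot{\boldsymbol{X}}\boldsymbol{\beta}\right).$$ Then $\widetilde{\boldsymbol{\beta}}$ must be $$\widetilde{\boldsymbol{\beta}}=\left(\sum_{i=1}^n\dot{\boldsymbol{X}}_i'\boldsymbol{Q}(\widetilde{\boldsymbol{\lambda}})\dot{\boldsymbol{X}}_i\right)^{-1}\sum_{i=1}^n\dot{\boldsymbol{X}}_i'\boldsymbol{Q}(\widetilde{\boldsymbol{\lambda}})\dot{\boldsymbol{y}}_i,$$ with $\boldsymbol{Q}(\boldsymbol{\lambda}):=\boldsymbol{I}_T-\boldsymbol{P}_{\boldsymbol{\Lambda}}$. Moreover, let the $m\times q$ matrix $\widehat{\boldsymbol{\Theta}}^{o}(\boldsymbol{\lambda})$ be such that $$\mathrm{vec}\left(\widehat{\boldsymbol{\Theta}}^{o}(\boldsymbol{\lambda})'\right)=\left((\dot{\boldsymbol{z}}\otimes\boldsymbol{\Lambda})'\boldsymbol{M}(\dot{\boldsymbol{z}}\otimes\boldsymbol{\Lambda})\right)^{-1}(\dot{\boldsymbol{z}}\otimes\boldsymbol{\Lambda})'\boldsymbol{M}\dot{\boldsymbol{y}}.$$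 Finally, set $\widetilde{\boldsymbol{\theta}}:=\mathrm{vec}(\widehat{\boldsymbol{\Theta}}^{o}(\widetilde{\boldsymbol{\lambda}}))$ and $\widetilde{\boldsymbol{\psi}}:=(\widetilde{\boldsymbol{\beta}}',\widetilde{\boldsymbol{\theta}}',\widetilde{\boldsymbol{\lambda}}')'$. Then $$S_n(\widetilde{\boldsymbol{\psi}})\le S_n(\boldsymbol{\psi})\quad\text{for all }\boldsymbol{\psi},$$ and therefore $\widehat{\boldsymbol{\psi}}=\widetilde{\boldsymbol{\psi}}$, where $\widehat{\boldsymbol{\psi}}$ is the nonlinear least squares estimate, i.e. the minimizer of $S_n$.
   Context: Data: for $i=1,\ldots,n$, $\boldsymbol{y}_i$ is a $T\times1$ vector and $\boldsymbol{X}_i$ a $T\times K$ matrix with $t$th row $\boldsymbol{x}_{it}'$; $\boldsymbol{z}_i$ is the $m\times1$ vector consisting of all distinct entries of $(\boldsymbol{x}_{i1}',\ldots,\boldsymbol{x}_{iT}')'$ (the positions kept being the same for all $i$). A dot denotes cross-sectional demeaning: $\dot{\boldsymbol{X}}_i=\boldsymbol{X}_i-\frac1n\sum_{j=1}^n\boldsymbol{X}_j$, and likewise $\dot{\boldsymbol{y}}_i,\dot{\boldsymbol{z}}_i$. Stack $\dot{\boldsymbol{y}}=(\dot{\boldsymbol{y}}_1',\ldots,\dot{\boldsymbol{y}}_n')'$ ($nT\times1$), $\dot{\boldsymbol{X}}=(\dot{\boldsymbol{X}}_1',\ldots,\dot{\boldsymbol{X}}_n')'$ ($nT\times K$), $\dot{\boldsymbol{z}}=(\dot{\boldsymbol{z}}_1,\ldots,\dot{\boldsymbol{z}}_n)'$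 ($n\times m$). Because each $\dot{\boldsymbol{x}}_{it}$ consists of entries of $\dot{\boldsymbol{z}}_i$, there is an $mT\times K$ matrix $\boldsymbol{S}$ of zeros and ones with $\dot{\boldsymbol{X}}=(\dot{\boldsymbol{z}}\otimes\boldsymbol{I}_T)\boldsymbol{S}$. Parameters: $1\le q<T$; $\boldsymbol{\psi}=(\boldsymbol{\beta}',\boldsymbol{\theta}',\boldsymbol{\lambda}')'\in\mathbb{R}^{K+q(m+T-q)}$ with $\boldsymbol{\beta}\in\mathbb{R}^K$, $\boldsymbol{\theta}=\mathrm{vec}(\boldsymbol{\Theta})$ for $\boldsymbol{\Theta}$ an $m\times q$ matrix, $\boldsymbol{\lambda}=\mathrm{vec}(\boldsymbol{\Lambda}_2)$ for $\boldsymbol{\Lambda}_2$ a $(T-q)\times q$ matrix, and $\boldsymbol{\Lambda}':=(\boldsymbol{I}_q,\boldsymbol{\Lambda}_2')$. Objective function: with $\dot{\boldsymbol{Z}}_i=\boldsymbol{I}_q\otimes\dot{\boldsymbol{z}}_i'$, $$S_n(\boldsymbol{\psi})=\frac1{2n}\sum_{i=1}^n(\dot{\boldsymbol{y}}_i-\dot{\boldsymbol{X}}_i\boldsymbol{\beta}-\boldsymbol{\Lambda}\dot{\boldsymbol{Z}}_i\boldsymbol{\theta})'(\dot{\boldsymbol{y}}_i-\dot{\boldsymbol{X}}_i\boldsymbol{\beta}-\boldsymbol{\Lambda}\dot{\boldsymbol{Z}}_i\boldsymbol{\theta}).$$ Projection matrices: $\boldsymbol{P}_{\dot{\boldsymbol{X}}}=\dot{\boldsymbol{X}}(\dot{\boldsymbol{X}}'\dot{\boldsymbol{X}})^{-1}\dot{\boldsymbol{X}}'$,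 $\boldsymbol{P}_{\boldsymbol{\Lambda}}=\boldsymbol{\Lambda}(\boldsymbol{\Lambda}'\boldsymbol{\Lambda})^{-1}\boldsymbol{\Lambda}'$, $\boldsymbol{P}_{\dot{\boldsymbol{z}}}=\dot{\boldsymbol{z}}(\dot{\boldsymbol{z}}'\dot{\boldsymbol{z}})^{-1}\dot{\boldsymbol{z}}'$; $\boldsymbol{M}:=\boldsymbol{I}_{nT}-\boldsymbol{P}_{\dot{\boldsymbol{X}}}$ and $\boldsymbol{M}(\boldsymbol{\lambda}):=\boldsymbol{I}_{nT}-(\boldsymbol{P}_{\dot{\boldsymbol{z}}}\otimes\boldsymbol{P}_{\boldsymbol{\Lambda}})$. Conventions: all inverses appearing in the formulas are assumed to exist (those depending on $\boldsymbol{\lambda}$, at $\boldsymbol{\lambda}=\widetilde{\boldsymbol{\lambda}}$), and the notation $\arg\min$ presumes that the minimizer exists and is unique. *)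

(* Defs.v *)
(* Kronecker products are [tensmx] of mathcomp-real-closed. *)
From HB Require Import structures.
From mathcomp Require Import all_boot all_order all_algebra.
From mathcomp Require Export mxtens.

Set Implicit Arguments.
Unset Strict Implicit.
Unset Printing Implicit Defensive.

Import Order.TTheory GRing.Theory Num.Theory.
Local Open Scope ring_scope.

Definition demean (R : realFieldType) (n a b : nat) (A : 'I_n -> 'M[R]_(a, b))
    (i : 'I_n) : 'M[R]_(a, b) :=
  A i - n%:R^-1 *: \sum_(j < n) A j.

(* [z i] keeps one copy of each distinct entry of [X i], at positions that do
   not depend on [i]. Two positions hold the same entry when they agree for
   every [i]; a coincidence of values for some of the [i] does not merge them. *)
Definition distinct_entries (R : realFieldType) (n T K m : nat)
    (X : 'I_n -> 'M[R]_(T, K)) (z : 'I_n -> 'cV[R]_m) : Prop :=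
  exists kept : 'I_m -> 'I_T * 'I_K,
    [/\ forall i j, z i j 0 = X i (kept j).1 (kept j).2,
        forall t k, exists j, forall i, X i t k = z i j 0
      & forall j j', (forall i, z i j 0 = z i j' 0) -> j = j'].

(* The block column (A_1', ..., A_n')': row t of block i is row i * a + t. *)
Definition stack (R : realFieldType) (n a b : nat) (A : 'I_n -> 'M[R]_(a, b)) :
    'M[R]_(n * a, b) :=
  \matrix_(k, l) A (mxtens_unindex k).1 (mxtens_unindex k).2 l.

(* The matrix with rows z_1', ..., z_n'. *)
Definition rows_of (R : realFieldType) (n m : nat) (z : 'I_n -> 'cV[R]_m) :
    'M[R]_(n, m) :=
  \matrix_(i, j) z i j 0.

(* Column-stacking vec; [mxvec] is row-major and returns a row vector. *)
Definition vec (R : realFieldType) (a b : nat) (A : 'M[R]_(a, b)) :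
    'cV[R]_(b * a) :=
  (mxvec A^T)^T.

(* The inverse of [vec]. *)
Definition unvec (R : realFieldType) (a b : nat) (v : 'cV[R]_(b * a)) :
    'M[R]_(a, b) :=
  (vec_mx v^T)^T.

(* Lambda = (I_q, Lambda_2')' with lambda = vec Lambda_2; the cast identifies
   q + (T - q) with T. *)
Definition loading (R : realFieldType) (T q : nat) (qT : (q < T)%N)
    (lambda : 'cV[R]_(q * (T - q))) : 'M[R]_(T, q) :=
  castmx (subnKC (ltnW qT), erefl q) (col_mx 1%:M (unvec lambda)).

(* I_q (x) z'; the cast identifies q * 1 with q. *)
Definition kronZ (R : realFieldType) (m : nat) (q : nat) (z : 'cV[R]_m) :
    'M[R]_(q, q * m) :=
  castmx (muln1 q, erefl (q * m)%N) ((1%:M : 'M[R]_q) *t z^T).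

(* The orthogonal projector on the column space of [A], provided that
   [A^T *m A] is invertible. *)
Definition proj (R : realFieldType) (a b : nat) (A : 'M[R]_(a, b)) : 'M[R]_a :=
  A *m invmx (A^T *m A) *m A^T.

Definition quad (R : realFieldType) (a : nat) (W : 'M[R]_a) (u : 'cV[R]_a) : R :=
  (u^T *m W *m u) 0 0.

(* [x] is the minimizer of [f]: it minimizes [f], and nothing else does. *)
Definition is_argmin (R : realFieldType) (V : Type) (f : V -> R) (x : V) : Prop :=
  (forall v, f x <= f v) /\
  (forall v, (forall w, f v <= f w) -> v = x).

(* S_n, evaluated at psi = (beta', theta', lambda')'; [y], [X], [z] are the
   demeaned data. *)
Definition Sn (R : realFieldType) (n T K m q : nat) (qT : (q < T)%N)
    (y : 'I_n -> 'cV[R]_T) (X : 'I_n -> 'M[R]_(T, K)) (z : 'I_n -> 'cV[R]_m)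
    (psi : 'cV[R]_(K + (q * m + q * (T - q)))) : R :=
  let beta := usubmx psi in
  let theta := usubmx (dsubmx psi) in
  let Lambda := loading qT (dsubmx (dsubmx psi)) in
  let resid i := y i - X i *m beta - Lambda *m kronZ q (z i) *m theta in
  (2 * n%:R)^-1 * \sum_(i < n) ((resid i)^T *m resid i) 0 0.

(* M(lambda) = I_{nT} - P_z (x) P_Lambda. *)
Definition Mlambda (R : realFieldType) (n T m q : nat) (qT : (q < T)%N)
    (z : 'M[R]_(n, m)) (lambda : 'cV[R]_(q * (T - q))) : 'M[R]_(n * T) :=
  1%:M - proj z *t proj (loading qT lambda).

Definition Qlambda (R : realFieldType) (T q : nat) (qT : (q < T)%N)
    (lambda : 'cV[R]_(q * (T - q))) : 'M[R]_T :=
  1%:M - proj (loading qT lambda).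

(* (y - X beta)' M(lambda) (y - X beta) as a function of
   alpha = (beta', lambda')', for stacked demeaned data. *)
Definition concentrated (R : realFieldType) (n T K m q : nat) (qT : (q < T)%N)
    (y : 'cV[R]_(n * T)) (X : 'M[R]_(n * T, K)) (z : 'M[R]_(n, m))
    (alpha : 'cV[R]_(K + q * (T - q))) : R :=
  quad (Mlambda qT z (dsubmx alpha)) (y - X *m usubmx alpha).

(* Main.v *)
Require Import Defs.
From HB Require Import structures.
From mathcomp Require Import all_boot all_order all_algebra.
From mathcomp Require Import mxtens.

Set Implicit Arguments.
Unset Strict Implicit.
Unset Printing Implicit Defensive.

Import Order.TTheory GRing.Theory Num.Theory.
Local Open Scope ring_scope.

(* For fixed lambda, S_n is 1/(2n) times the squared norm of
     ys - Xs beta - (zs (x) Lambda) vec(Theta'),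
   whose minimum over Theta is the concentrated objective, since P_zs (x) P_Lambda
   projects orthogonally onto the column space of zs (x) Lambda; Lambda'Lambda is
   invertible for every lambda because Lambda contains the block I_q. Hence S_n
   is bounded below by the concentrated objective at (betat, lambdat), and the
   bound is attained at psit by the Frisch-Waugh-Lovell identity. The columns of
   Xs lie in the column space of zs (x) I_T, so M(lambda) Xs = (I_n (x) Q(lambda)) Xs,
   which turns the generalized least squares formula for betat into sums over i. *)

(** * Row-major and Kronecker indexings of pairs *)

Lemma index_allpairs_pair (S T : eqType) (s : seq S) (t : seq T) x y :
  x \in s -> y \in t ->
  index (x, y) [seq (x', y') | x' <- s, y' <- t]
  = (index x s * size t + index y t)%N.
Proof.
move=> + ty; elim: s => // a s IHs; rewrite inE allpairs_cons index_cat /=.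
have [<- _|neq_ax /= sx] := eqVneq a x.
  by rewrite map_f // index_map // => ? ? [].
rewrite ifF ?size_map ?IHs //.
  by rewrite mulSn addnA.
by apply/mapP => -[y' _ [eq_xa _]]; rewrite eq_xa eqxx in neq_ax.
Qed.

(** [vec] rests on [mxvec], while [stack] and [*t] rest on [mxtens_index]; both enumerate pairs row
    by row, so entries of all three can be compared. *)
Lemma mxvec_index_mxtens (m n : nat) (i : 'I_m) (j : 'I_n) :
  mxvec_index i j = mxtens_index (i, j).
Proof.
apply: val_inj; rewrite /= /enum_rank enum_rank_in.unlock insubdK.
  rewrite enumT unlock /= /prod_enum index_allpairs_pair ?mem_enum //.
  by rewrite !index_enum_ord size_enum_ord.
by rewrite -topredE /= cardE index_mem mem_enum.
Qed.

Section LeastSquares.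
Variable R : realFieldType.

(** * Stacked, vectorised and Kronecker matrices *)

Lemma big_mxtens (m n : nat) (F : 'I_(m * n) -> R) :
  \sum_(k < m * n) F k = \sum_(i < m) \sum_(j < n) F (mxtens_index (i, j)).
Proof.
rewrite pair_big (reindex (@mxtens_index m n)) /=.
  by apply: eq_bigr => -[i j] _.
by exists (@mxtens_unindex m n) => k _; rewrite (mxtens_indexK, mxtens_unindexK).
Qed.

Lemma vecE (a b : nat) (A : 'M[R]_(a, b)) i j :
  vec A (mxtens_index (j, i)) 0 = A i j.
Proof. by rewrite mxE -mxvec_index_mxtens mxvecE mxE. Qed.

Lemma unvecK (a b : nat) (v : 'cV[R]_(b * a)) : vec (unvec v) = v.
Proof. by rewrite /vec /unvec trmxK vec_mxK trmxK. Qed.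

Lemma stackE (n a b : nat) (A : 'I_n -> 'M[R]_(a, b)) i t k :
  stack A (mxtens_index (i, t)) k = A i t k.
Proof. by rewrite mxE mxtens_indexK. Qed.

Lemma tens1_stack (n a b c : nat) (B : 'M[R]_(c, a)) (A : 'I_n -> 'M[R]_(a, b)) :
  (1%:M *t B) *m stack A = stack (fun i => B *m A i).
Proof.
apply/matrixP => k l; case: (mxtens_indexP k) => i t.
rewrite stackE !mxE big_mxtens (bigD1 i) //= [X in _ + X]big1 ?addr0 => [|j neq_ji].
  by apply: eq_bigr => s _; rewrite tensmxE stackE mxE eqxx mul1r.
by apply: big1 => s _; rewrite tensmxE mxE eq_sym (negPf neq_ji) !mul0r.
Qed.

Lemma tr_stack_mul (n a b c : nat) (A : 'I_n -> 'M[R]_(a, b))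
    (B : 'I_n -> 'M[R]_(a, c)) :
  (stack A)^T *m stack B = \sum_(i < n) (A i)^T *m B i.
Proof.
apply/matrixP => k l; rewrite mxE summxE big_mxtens.
apply: eq_bigr => i _; rewrite mxE; apply: eq_bigr => t _.
by rewrite mxE !stackE mxE.
Qed.

Lemma kronZE (m q : nat) (z : 'cV[R]_m) j j' i :
  kronZ q z j (mxtens_index (j', i)) = (j == j')%:R * z i 0.
Proof.
have -> : j = cast_ord (muln1 q) (mxtens_index (j, 0)).
  by apply: val_inj; rewrite /= muln1 addn0.
rewrite castmxE cast_ord_id cast_ordK tensmxE !mxE; congr ((_ == _)%:R * _).
by apply: val_inj; rewrite /= muln1 addn0.
Qed.

Lemma kronZ_vec (m q : nat) (z : 'cV[R]_m) (Theta : 'M[R]_(m, q)) :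
  kronZ q z *m vec Theta = Theta^T *m z.
Proof.
apply/matrixP => j o; rewrite {o}ord1 !mxE big_mxtens (bigD1 j) //=.
rewrite [X in _ + X]big1 ?addr0 => [|j' neq_j].
  by apply: eq_bigr => i _; rewrite vecE kronZE mxE eqxx mul1r mulrC.
by apply: big1 => i _; rewrite kronZE eq_sym (negPf neq_j) !mul0r.
Qed.

(** Block i of both sides is L Theta' z_i. For fixed lambda the residual is thus affine in
    vec(Theta'). *)
Lemma tens_rows_vec (n T m q : nat) (z : 'I_n -> 'cV[R]_m)
    (L : 'M[R]_(T, q)) (Theta : 'M[R]_(m, q)) :
  (rows_of z *t L) *m vec Theta^T
  = stack (fun i => L *m kronZ q (z i) *m vec Theta).
Proof.
apply/matrixP => k o; case: (mxtens_indexP k) => i t; rewrite {o}ord1.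
rewrite stackE -mulmxA kronZ_vec mulmxA !mxE big_mxtens.
apply: eq_bigr => j _; rewrite mxE mulr_suml; apply: eq_bigr => s _.
by rewrite vecE tensmxE !mxE [RHS]mulrC mulrA.
Qed.

(** * Squared norms and the Gram matrix of Lambda *)

Definition sqnorm (a : nat) (u : 'cV[R]_a) : R := (u^T *m u) 0 0.

Lemma sqnormE a (u : 'cV[R]_a) : sqnorm u = \sum_i u i 0 ^+ 2.
Proof. by rewrite /sqnorm mxE; apply: eq_bigr => i _; rewrite mxE expr2. Qed.

Lemma sqnorm_ge0 a (u : 'cV[R]_a) : 0 <= sqnorm u.
Proof. by rewrite sqnormE sumr_ge0 // => i _; rewrite sqr_ge0. Qed.

Lemma sqnorm_eq0 a (u : 'cV[R]_a) : sqnorm u = 0 -> u = 0.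
Proof.
rewrite sqnormE => /eqP; rewrite psumr_eq0 => [/allP u0|i _]; last exact: sqr_ge0.
apply/matrixP => i j; rewrite ord1 mxE.
by have := u0 i (mem_index_enum i); rewrite /= sqrf_eq0 => /eqP.
Qed.

Lemma sqnormD_orth a (u v : 'cV[R]_a) :
  u^T *m v = 0 -> sqnorm (u + v) = sqnorm u + sqnorm v.
Proof.
move=> uv0; have vu0 : v^T *m u = 0 by rewrite -[u]trmxK -trmx_mul uv0 trmx0.
by rewrite /sqnorm [(u + v)^T]linearD /= mulmxDl !mulmxDr uv0 vu0 addr0 add0r mxE.
Qed.

Lemma sqnorm_stack n a (u : 'I_n -> 'cV[R]_a) :
  sqnorm (stack u) = \sum_i ((u i)^T *m u i) 0 0.
Proof. by rewrite /sqnorm tr_stack_mul summxE. Qed.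

(** The top block of the product is [w] itself. The equation [e] is kept general so that case
    analysis on it removes the cast. *)
Lemma castmx_col1_inj q r T (e : (q + r)%N = T) (B : 'M[R]_(r, q)) (w : 'cV[R]_q) :
  castmx (e, erefl q) (col_mx 1%:M B) *m w = 0 -> w = 0.
Proof.
case: T / e; rewrite castmx_id mul_col_mx mul1mx => /(congr1 usubmx).
by rewrite col_mxKu linear0.
Qed.

(** If the Gram matrix kills a row [v], then Lambda v' has zero norm, so [v] vanishes. Comparison
    with an arbitrary psi calls for this at every lambda. *)
Lemma loading_gram_unit T q (qT : (q < T)%N) (lambda : 'cV[R]_(q * (T - q))) :
  (loading qT lambda)^T *m loading qT lambda \in unitmx.
Proof.
rewrite -row_free_unit; apply: inj_row_free => v vLL0.
have /castmx_col1_inj v0 : loading qT lambda *m v^T = 0.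
  apply: sqnorm_eq0; rewrite /sqnorm trmx_mul trmxK mulmxA -[v *m _ *m _]mulmxA.
  by rewrite vLL0 mul0mx mxE.
by apply: trmx_inj; rewrite v0 trmx0.
Qed.

(** * Projectors, generalized least squares and partialling out *)

Section Projector.
Variables (a b : nat) (A : 'M[R]_(a, b)).

Lemma tr_proj : (proj A)^T = proj A.
Proof. by rewrite /proj !trmx_mul trmxK trmx_inv trmx_mul trmxK mulmxA. Qed.

Lemma proj_id : A^T *m A \in unitmx -> proj A *m A = A.
Proof. by move=> uA; rewrite /proj -!mulmxA mulVmx ?mulmx1. Qed.
End Projector.

Section Residual.
(* [P] is the orthogonal projector on the column space of [B], with [C] giving
   the least squares coefficients: this covers both [proj B] and the
   Kronecker product of two projectors. *)
Variables (a b : nat) (B : 'M[R]_(a, b)) (C : 'M[R]_(b, a)).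
Let P := B *m C.
Hypotheses (P_sym : P^T = P) (PB : P *m B = B).

Let W := 1%:M - P.

Lemma resid_sym : W^T = W.
Proof. by rewrite /W linearB /= trmx1 P_sym. Qed.

Lemma resid_ann : W *m B = 0.
Proof. by rewrite /W mulmxBl mul1mx PB subrr. Qed.

Lemma resid_idem : W *m W = W.
Proof. by rewrite {2}/W mulmxBr mulmx1 /P mulmxA resid_ann mul0mx subr0. Qed.

Lemma tr_resid_orth (u : 'cV[R]_a) : B^T *m (W *m u) = 0.
Proof. by rewrite mulmxA -resid_sym -trmx_mul resid_ann trmx0 mul0mx. Qed.

Lemma quad_resid (u : 'cV[R]_a) : quad W u = sqnorm (W *m u).
Proof.
by rewrite /quad /sqnorm trmx_mul resid_sym mulmxA -[u^T *m W *m W]mulmxA resid_idem.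
Qed.

(** Pythagoras: [W *m u] is orthogonal to the columns of [B], and the rest of [u - B *m d] lies in
    their span. *)
Lemma quad_resid_le (u : 'cV[R]_a) (d : 'cV[R]_b) :
  quad W u <= sqnorm (u - B *m d).
Proof.
have -> : u - B *m d = W *m u + B *m (C *m u - d).
  by rewrite /W mulmxBl mul1mx mulmxBr /P -mulmxA addrA subrK.
rewrite sqnormD_orth ?quad_resid ?lerDl ?sqnorm_ge0 //.
by rewrite mulmxA -[_ *m B]trmxK trmx_mul trmxK tr_resid_orth trmx0 mul0mx.
Qed.

Variables (k : nat) (X : 'M[R]_(a, k)) (y : 'cV[R]_a).
Hypothesis uX : X^T *m W *m X \in unitmx.

Let gls := invmx (X^T *m W *m X) *m (X^T *m W *m y).

Lemma gls_normal_eq : X^T *m W *m (y - X *m gls) = 0.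
Proof. by rewrite mulmxBr [_ *m (X *m _)]mulmxA /gls mulKVmx ?subrr. Qed.

(** Pythagoras again: by the normal equations and W'W = W, the weighted residual at [gls] is
    orthogonal to [W *m X]. *)
Lemma gls_le (beta : 'cV[R]_k) : quad W (y - X *m gls) <= quad W (y - X *m beta).
Proof.
have -> : y - X *m beta = (y - X *m gls) + X *m (gls - beta).
  by rewrite mulmxBr addrA subrK.
rewrite !quad_resid [W *m (_ + X *m _)]mulmxDr sqnormD_orth ?lerDl ?sqnorm_ge0 //.
apply: trmx_inj; rewrite trmx0 trmx_mul trmxK !trmx_mul resid_sym -!mulmxA.
by rewrite [W *m (W *m _)]mulmxA resid_idem [X^T *m _]mulmxA gls_normal_eq mulmx0.
Qed.

(* Frisch-Waugh-Lovell: after [X] is partialled out, regressing on [B] gives the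
   [B]-coefficients of the joint regression on [(X, B)]. *)
Lemma fwl (M := 1%:M - proj X) :
    X^T *m X \in unitmx -> B^T *m M *m B \in unitmx ->
  W *m (y - X *m gls)
  = y - X *m gls - B *m (invmx (B^T *m M *m B) *m B^T *m M *m y).
Proof.
move=> uXX uB; set r := y - X *m gls; pose d := C *m r.
have MX : M *m X = 0 by rewrite /M mulmxBl mul1mx proj_id // subrr.
have Wr : W *m r = r - B *m d by rewrite {1}/W mulmxBl mul1mx /P mulmxA.
rewrite Wr; congr (_ - B *m _).
have XWr : X^T *m (W *m r) = 0 by rewrite mulmxA gls_normal_eq.
(* The normal equations make [W *m r] orthogonal to [X], so partialling out [X] leaves it
   unchanged. *)
have MWr : M *m (W *m r) = W *m r.
  by rewrite /M mulmxBl mul1mx /proj -[_ *m X^T *m _]mulmxA XWr mulmx0 subr0.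
have BMWr : B^T *m M *m (W *m r) = 0 by rewrite -mulmxA MWr tr_resid_orth.
have Mr : M *m r = M *m y by rewrite /r mulmxBr mulmxA MX mul0mx subr0.
(* Applying B'M to W r = r - B d kills the left side: [d] solves the normal equations of the
   partialled-out regression. *)
have BMy : B^T *m (M *m y) = B^T *m M *m B *m d.
  clearbody M r d; apply/eqP; rewrite -subr_eq0 -Mr (mulmxA B^T M r).
  by rewrite -(mulmxA _ B d) -mulmxBr -Wr BMWr.
by clearbody M; rewrite -[RHS]mulmxA -[RHS]mulmxA BMy mulKmx.
Qed.
End Residual.

(** * Kronecker products of projectors acting on the stacked data *)

Section TensProjector.
Variables (n m T q : nat) (Z : 'M[R]_(n, m)) (L : 'M[R]_(T, q)).
Let C := (invmx (Z^T *m Z) *m Z^T) *t (invmx (L^T *m L) *m L^T).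

Lemma tens_projE : proj Z *t proj L = (Z *t L) *m C.
Proof. by rewrite tensmx_mul !mulmxA. Qed.

Lemma tens_proj_sym : ((Z *t L) *m C)^T = (Z *t L) *m C.
Proof. by rewrite -tens_projE trmx_tens !tr_proj. Qed.

Lemma tens_proj_id :
  Z^T *m Z \in unitmx -> L^T *m L \in unitmx ->
  (Z *t L) *m C *m (Z *t L) = Z *t L.
Proof. by move=> uZ uL; rewrite -tens_projE tensmx_mul !proj_id. Qed.
End TensProjector.

Lemma stack_sel (n T K m : nat) (X : 'I_n -> 'M[R]_(T, K))
    (z : 'I_n -> 'cV[R]_m) :
  distinct_entries X z ->
  exists S : 'M[R]_(m * T, K),
    stack (demean X) = (rows_of (demean z) *t 1%:M) *m S.
Proof.
case=> _ [_ Xz _]; have /fin_all_exists[f fP] t := fin_all_exists (Xz t).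
(* Row (j, t), column k is 1 exactly when x_itk is entry j of z_i. As [f] does not depend on i, this
   selection commutes with demeaning. *)
pose S := \matrix_(r, k) ((f (mxtens_unindex r).2 k == (mxtens_unindex r).1)%:R : R).
have SE j t k : S (mxtens_index (j, t)) k = (f t k == j)%:R.
  by rewrite mxE mxtens_indexK.
exists S; apply/matrixP => r k; case: (mxtens_indexP r) => i t.
have XzE j : X j t k = z j (f t k) 0 by exact: fP.
rewrite stackE [RHS]mxE big_mxtens (bigD1 (f t k)) //= [X in _ + X]big1 => [|j neq_j].
  rewrite addr0 (bigD1 t) //= [X in _ + X]big1 => [|s neq_s].
    rewrite tensmxE SE !mxE !eqxx !mulr1 addr0 XzE !summxE.
    by congr (_ - _ * _); apply: eq_bigr => j _; rewrite XzE.
  by rewrite tensmxE [1%:M _ _]mxE eq_sym (negPf neq_s) mulr0 mul0r.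
apply: big1 => s _; rewrite tensmxE [1%:M _ _]mxE SE.
by case: (eqVneq t s) => [<-|_]; rewrite ?mulr0 ?mul0r // eq_sym (negPf neq_j) mulr0.
Qed.

(** With Xs = (zs (x) I_T) S, the factor P_zs is absorbed by zs, leaving zs (x) (I_T - P_L). *)
Lemma tens_proj_stack (n T K m q : nat) (X : 'I_n -> 'M[R]_(T, K))
    (z : 'I_n -> 'cV[R]_m) (L : 'M[R]_(T, q)) (zs := rows_of (demean z)) :
  distinct_entries X z -> zs^T *m zs \in unitmx ->
  (1%:M - proj zs *t proj L) *m stack (demean X)
  = stack (fun i => (1%:M - proj L) *m demean X i).
Proof.
move=> Xz uz; rewrite -tens1_stack.
have [S ->] := stack_sel Xz; rewrite !mulmxA; congr (_ *m S).
rewrite mulmxBl mul1mx !tensmx_mul proj_id // mul1mx !mulmx1.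
by apply/matrixP => i j; rewrite !mxE mulrBr.
Qed.

Lemma SnE (n T K m q : nat) (qT : (q < T)%N)
    (y : 'I_n -> 'cV[R]_T) (X : 'I_n -> 'M[R]_(T, K)) (z : 'I_n -> 'cV[R]_m)
    (beta : 'cV[R]_K) (Theta : 'M[R]_(m, q)) (lambda : 'cV[R]_(q * (T - q))) :
  Sn qT y X z (col_mx beta (col_mx (vec Theta) lambda))
  = (2 * n%:R)^-1 * sqnorm (stack y - stack X *m beta
                            - (rows_of z *t loading qT lambda) *m vec Theta^T).
Proof.
rewrite /Sn !(col_mxKu, col_mxKd) tens_rows_vec -sqnorm_stack.
congr (_ * sqnorm _); apply/matrixP => r k; rewrite !mxE; congr (_ - _ - _).
by apply: eq_bigr => j _; rewrite mxE.
Qed.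

End LeastSquares.

Theorem theorem4 (R : realFieldType) (n T K m q : nat)
  (n_gt0 : (0 < n)%N) (q_gt0 : (1 <= q)%N) (qT : (q < T)%N)
  (y : 'I_n -> 'cV[R]_T) (X : 'I_n -> 'M[R]_(T, K)) (z : 'I_n -> 'cV[R]_m)
  (Xz : distinct_entries X z)
  (betat : 'cV[R]_K) (lambdat : 'cV[R]_(q * (T - q)))
  (Thetao : 'cV[R]_(q * (T - q)) -> 'M[R]_(m, q)) :
  let yd := demean y in
  let Xd := demean X in
  let ys := stack yd in
  let Xs := stack Xd in
  let zs := rows_of (demean z) in
  let Lambda := fun lambda => loading qT lambda in
  let Q := fun lambda => Qlambda qT lambda in
  let M := 1%:M - proj Xs in
  let S := Sn qT yd Xd (demean z) in
  (* existence of the inverses *)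
  Xs^T *m Xs \in unitmx ->
  zs^T *m zs \in unitmx ->
  (Lambda lambdat)^T *m Lambda lambdat \in unitmx ->
  \sum_(i < n) (Xd i)^T *m Q lambdat *m Xd i \in unitmx ->
  (zs *t Lambda lambdat)^T *m M *m (zs *t Lambda lambdat) \in unitmx ->
  is_argmin (concentrated qT ys Xs zs) (col_mx betat lambdat) ->
  (forall lambda,
     vec (Thetao lambda)^T =
     invmx ((zs *t Lambda lambda)^T *m M *m (zs *t Lambda lambda))
       *m (zs *t Lambda lambda)^T *m M *m ys) ->
  let psit := col_mx betat (col_mx (vec (Thetao lambdat)) lambdat) in
  [/\ betat = invmx (\sum_(i < n) (Xd i)^T *m Q lambdat *m Xd i)
              *m \sum_(i < n) (Xd i)^T *m Q lambdat *m yd i,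
      forall psi, S psit <= S psi
    & forall psihat, is_argmin S psihat -> psihat = psit].
Proof.
move=> yd Xd ys Xs zs Lambda Q M S uX uz uL uQ uM [min_conc uniq_conc] ThetaE psit.
pose C l := (invmx (zs^T *m zs) *m zs^T)
              *t (invmx ((Lambda l)^T *m Lambda l) *m (Lambda l)^T).
have MlE l : Mlambda qT zs l = 1%:M - (zs *t Lambda l) *m C l.
  by rewrite /Mlambda tens_projE.
have Psym l : ((zs *t Lambda l) *m C l)^T = (zs *t Lambda l) *m C l.
  exact: tens_proj_sym.
have PB l : (zs *t Lambda l) *m C l *m (zs *t Lambda l) = zs *t Lambda l.
  by apply: tens_proj_id => //; apply: loading_gram_unit.
have WXs : Mlambda qT zs lambdat *m Xs = stack (fun i => Q lambdat *m Xd i).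
  exact: tens_proj_stack.
have XsW : Xs^T *m Mlambda qT zs lambdat = (stack (fun i => Q lambdat *m Xd i))^T.
  by rewrite -WXs trmx_mul MlE resid_sym.
have QXd i : (Q lambdat *m Xd i)^T = (Xd i)^T *m Q lambdat.
  by rewrite trmx_mul /Q /Qlambda [(1%:M - _)^T]linearB /= trmx1 tr_proj.
have XWX : Xs^T *m Mlambda qT zs lambdat *m Xs
           = \sum_(i < n) (Xd i)^T *m Q lambdat *m Xd i.
  by rewrite XsW tr_stack_mul; apply: eq_bigr => i _; rewrite QXd.
have XWy : Xs^T *m Mlambda qT zs lambdat *m ys
           = \sum_(i < n) (Xd i)^T *m Q lambdat *m yd i.
  by rewrite XsW tr_stack_mul; apply: eq_bigr => i _; rewrite QXd.
have uXWX : Xs^T *m Mlambda qT zs lambdat *m Xs \in unitmx by rewrite XWX.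
have betaE : betat = invmx (Xs^T *m Mlambda qT zs lambdat *m Xs)
                       *m (Xs^T *m Mlambda qT zs lambdat *m ys).
  pose gls := invmx (Xs^T *m Mlambda qT zs lambdat *m Xs)
                *m (Xs^T *m Mlambda qT zs lambdat *m ys).
  (* At fixed [lambdat], [gls] does at least as well as [betat], so ([gls], [lambdat]) is also a
     minimizer and uniqueness identifies the two. *)
  have /uniq_conc/eq_col_mx[<- _ //] : forall alpha,
    concentrated qT ys Xs zs (col_mx gls lambdat) <= concentrated qT ys Xs zs alpha.
  move=> alpha; apply: le_trans (min_conc alpha).
  rewrite /concentrated !col_mxKu !col_mxKd /gls MlE; apply: gls_le => //.
  by rewrite -MlE.
have minS psi : S psit <= S psi.
  rewrite -[psi]vsubmxK -[dsubmx psi]vsubmxK -[usubmx (dsubmx psi)]unvecK.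
  rewrite /S !SnE ler_wpM2l ?invr_ge0 ?mulr_ge0 ?ler0n //.
  (* By [fwl] the residual at [psit] is M(lambdat)(ys - Xs betat), whose squared norm is the
     concentrated minimum. *)
  rewrite ThetaE betaE MlE -fwl -?MlE //.
  rewrite -/Xs -/ys -/zs -betaE MlE -quad_resid -?MlE //.
  (* That minimum is at most the concentrated objective at the (beta, lambda) of [psi], which bounds
     the squared norm for any Theta. *)
  have := min_conc (col_mx (usubmx psi) (dsubmx (dsubmx psi))).
  rewrite /concentrated !col_mxKu !col_mxKd => /le_trans; apply.
  by rewrite MlE quad_resid_le.
split=> //; first by rewrite -XWX -XWy.
by move=> psihat [_ uniq_hat]; rewrite (uniq_hat psit).
Qed.
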